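(* Let $G$ be a Polish group and let $X$ be a quasi-Polish space equipped with a Borel action $\alpha : G \times X \to X$ of $G$ (Borel with respect to the Borel $\sigma$-algebras generated by the topologies). Then: (a) The action is jointly continuous if and only if $\mathcal{O}(G) \circledast \mathcal{O}(X) = \mathcal{O}(X)$, i.e., the sets $U * A$ for $U \in \mathcal{O}(G)$ and $A \in \mathcal{O}(X)$ are open and form an open (sub)basis for $X$. (b) If $\mathcal{O}(G) \circledast \mathcal{O}(X) \subseteq \mathcal{O}(X)$, then $\mathcal{O}(G) \circledast \mathcal{O}(X)$ is a topology on $X$, coarser than $\mathcal{O}(X)$, which is a compatible quasi-Polish topology (i.e., quasi-Polish and contained in the Borel $\sigma$-algebra of $X$) and for which the action is jointly continuous.
   Context: $\mathcal{O}(Z)$ denotes the topology (set of open sets) of a space $Z$. Quasi-Polish spaces are in the sense of de Brecht (equivalently, spaces homeomorphic to a $\boldsymbol{\Pi}^0_2$ subspace of $\mathbb{S}^{\mathbb{N}}$, $\mathbb{S}$ the Sierpinski space). For Borel $U \subseteq G$ and Borel $A \subseteq X$, the Vaught transform is $U * A := \{x \in X \mid \exists^* g \in G\, (g \in U \text{ and } x \in gA)\}$, where $\exists^* g \in G$ means ''for a nonmeager set of $g \in G$''. For a family $\mathcal{S}$ of Borel subsets of $X$, $\mathcal{O}(G) \circledast \mathcal{S} := \{\bigcup_i (U_i * A_i) \mid U_i \in \mathcal{O}(G),\ A_i \in \mathcal{S}\}$, where $i$ ranges over countable index sets. *)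

(* Defs.v *)
From HB Require Import structures.
From mathcomp Require Import all_boot all_order all_algebra.
From mathcomp Require Import all_classical all_reals all_analysis.

Set Implicit Arguments.
Unset Strict Implicit.
Unset Printing Implicit Defensive.

Import Order.TTheory GRing.Theory Num.Theory.

Local Open Scope classical_set_scope.
Local Open Scope ring_scope.

HB.mixin Record isTopologicalGroup G & Topological G & Group G := {
  mulg_continuous : continuous (fun p : G * G => (p.1 * p.2)%g) ;
  invg_continuous : continuous (fun g : G => (g^-1)%g)
}.

#[short(type="topologicalGroupType")]
HB.structure Definition TopologicalGroup :=
  {G of Topological G & Group G & isTopologicalGroup G}.

Section polish.
Variable R : realType.

Definition is_metric (T : Type) (d : T -> T -> R) :=
  [/\ forall x y, 0 <= d x y,
      forall x y, d x y = 0 <-> x = y,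
      forall x y, d x y = d y x
    & forall x y z, d x z <= d x y + d y z].

Definition metrizes (T : topologicalType) (d : T -> T -> R) :=
  forall x : T, nbhs x = filter_from [set e : R | 0 < e]
                                     (fun e => [set y | d x y < e]).

Definition complete_metric (T : topologicalType) (d : T -> T -> R) :=
  forall u : nat -> T,
    (forall e : R, 0 < e -> exists N : nat, forall m n : nat,
       (N <= m)%N -> (N <= n)%N -> d (u m) (u n) < e) ->
    exists l : T, u @ \oo --> l.

Definition completely_metrizable (T : topologicalType) :=
  exists d : T -> T -> R, [/\ is_metric d, metrizes d & complete_metric d].

Definition separable_space (T : topologicalType) :=
  exists2 D : set T, countable D & dense D.

Definition polish (T : topologicalType) :=
  separable_space T /\ completely_metrizable T.

End polish.

Definition homeomorphic (S T : topologicalType) :=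
  exists (f : S -> T) (g : T -> S),
    [/\ cancel f g, cancel g f, continuous f & continuous g].

Definition sierpinski : Type := bool.

HB.instance Definition _ := Choice.on sierpinski.

Section sierpinski_topology.

(* The open sets are set0, [set true] and setT. *)
Definition sierpinski_open : set (set sierpinski) :=
  [set A | A false -> A true].

Lemma sierpinski_openT : sierpinski_open setT.
Proof. by []. Qed.

Lemma sierpinski_openI : setI_closed sierpinski_open.
Proof. by move=> A B oA oB [/oA At /oB Bt]. Qed.

Lemma sierpinski_open_bigU (I : Type) (f : I -> set sierpinski) :
  (forall i, sierpinski_open (f i)) -> sierpinski_open (\bigcup_i f i).
Proof. by move=> of_ [i _ /of_ fit]; exists i. Qed.

HB.instance Definition _ := isOpenTopological.Build sierpinski
  sierpinski_openT sierpinski_openI sierpinski_open_bigU.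

End sierpinski_topology.

(* In a non-metrizable space open sets need not be countable unions of closed
   sets, so the second level of the Borel hierarchy starts from differences of
   open sets. *)
Definition Sigma02 (T : topologicalType) (A : set T) :=
  exists U V : nat -> set T,
    [/\ forall n, open (U n), forall n, open (V n)
      & A = \bigcup_n (U n `\` V n)].

Definition Pi02 (T : topologicalType) (A : set T) := Sigma02 (~` A).

Definition quasi_polish (T : topologicalType) :=
  exists A : set {ptws nat -> sierpinski},
    Pi02 A /\ homeomorphic T (set_type A).

Definition borel (T : topologicalType) : set (set T) := <<s @open T >>.

Definition borel_map (S T : topologicalType) (f : S -> T) :=
  forall B : set T, borel B -> borel (f @^-1` B).

Definition nowhere_dense (T : topologicalType) (A : set T) :=
  interior (closure A) = set0.

Definition meager (T : topologicalType) (A : set T) :=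
  exists2 F : nat -> set T, forall n, nowhere_dense (F n) &
    A = \bigcup_n F n.

Definition left_action (G : groupType) (X : Type) (alpha : G * X -> X) :=
  (forall x, alpha (1%g, x) = x) /\
  (forall g h x, alpha ((g * h)%g, x) = alpha (g, alpha (h, x))).

Definition vaught (G : topologicalType) (X : Type) (alpha : G * X -> X)
    (U : set G) (A : set X) : set X :=
  [set x | ~ meager [set g | U g /\ [set alpha (g, a) | a in A] x]].

Definition vaught_unions (G : topologicalType) (X : Type) (alpha : G * X -> X)
    (UU : set (set G)) (SS : set (set X)) : set (set X) :=
  [set B | exists (I : set nat) (U : nat -> set G) (A : nat -> set X),
     [/\ forall i, I i -> UU (U i), forall i, I i -> SS (A i)
       & B = \bigcup_(i in I) vaught alpha (U i) (A i)]].

Definition subbasis (T : topologicalType) (B : set (set T)) :=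
  B `<=` open /\ basis (finI_from B id).

Definition is_topology (T : Type) (O : set (set T)) :=
  [/\ O setT, setI_closed O
    & forall F : set (set T), F `<=` O -> O (\bigcup_(A in F) A)].

(* The carrier of T equipped with the topology O. *)
Definition topologized (T : choiceType) (O : set (set T))
  (_ : is_topology O) : Type := T.

Section topologized_topology.
Variables (T : choiceType) (O : set (set T)) (topO : is_topology O).

HB.instance Definition _ := Choice.on (topologized topO).

Let openT : O setT. Proof. by case: topO. Qed.

Let openI : setI_closed O. Proof. by case: topO. Qed.

Let open_bigU (I : Type) (f : I -> set T) :
  (forall i, O (f i)) -> O (\bigcup_i f i).
Proof.
case: topO => _ _ OU Of; suff -> : \bigcup_i f i = \bigcup_(A in range f) A.
  by apply: OU => _ [i _ <-].
by rewrite bigcup_image.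
Qed.

HB.instance Definition _ := isOpenTopological.Build (topologized topO)
  openT openI open_bigU.

Lemma open_topologizedE : @open (topologized topO) = O.
Proof. by []. Qed.

End topologized_topology.

(* Main.v *)
(** Write [U * A] for the Vaught transform.  If [k] is a point of local
nonmeagerness of [[set g | A (g^-1 x)]] and [W], [C] are neighbourhoods of [1]
and [k] with [W C <= U], then [x \in C * A] and [W . (C * A) <= U * A].
This single observation yields both the continuity of the action for the
topology generated by the sets [U * A] and the closure of that family of unions
under intersections.

For quasi-Polishness, call [x] good when [x \in A] implies [x \in V * A] for
all basic open [A] and all neighbourhoods [V] of [1].  The good points form a
[Pi02] subset [X'] of [X], and [g^-1 x] is good for comeagerly many [g], so the
action restricts to a continuous open surjection from [G * X'] onto [X] with
the topology of the [U * A].  The image is T0 because Borel sets have the Baire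
property, and a T0 continuous open image of a quasi-Polish space is
quasi-Polish: a point of the powerset of the base lies in the image as soon as
a convergent chain of basic sets of [G * X'] can be followed through it, which
is a [Pi02] condition. *)

Require Import Defs.
From mathcomp Require Import all_boot all_order all_algebra.
From mathcomp Require Import all_classical all_reals all_analysis.
From mathcomp Require Import lra.

Set Implicit Arguments.
Unset Strict Implicit.
Unset Printing Implicit Defensive.

Import Order.TTheory GRing.Theory Num.Theory.

Local Open Scope classical_set_scope.

(** * Meager sets and the Baire property *)

Definition open_base (T : topologicalType) (K : Type) (U : K -> set T) :=
  (forall k, open (U k)) /\
  (forall x V, open V -> V x -> exists2 k, U k x & U k `<=` V).

Definition baire_space (T : topologicalType) :=
  forall V : set T, open V -> V !=set0 -> ~ meager V.

Definition locally_nonmeager (T : topologicalType) (S : set T) (x : T) :=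
  forall V, open V -> V x -> ~ meager (S `&` V).

Definition baire_property (T : topologicalType) (S : set T) :=
  exists2 O, open O & meager ((S `\` O) `|` (O `\` S)).

Section meager.
Context {T : topologicalType}.
Implicit Types A B S V : set T.

Lemma nowhere_denseP A : nowhere_dense A <->
  forall V, open V -> V !=set0 ->
    exists W, [/\ open W, W !=set0, W `<=` V & W `&` A = set0].
Proof.
split=> [ndA V oV [x Vx]|H].
  have /existsNP[y /not_implyP[Vy nAy]] : ~ (V `<=` closure A).
    move=> VA; suff : interior (closure A) x by rewrite ndA.
    by apply: (filterS VA); exact: open_nbhs_nbhs.
  exists (V `&` ~` closure A); split.
  - apply: openI => //; apply: closed_openC; exact: closed_closure.
  - by exists y.
  - by move=> ? [].
  - by apply/seteqP; split=> // z [[_ nz] /subset_closure].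
apply/seteqP; split=> // x xA.
have [||W [oW [z Wz] WA]] := H (interior (closure A)).
- exact: open_interior.
- by exists x.
move=> /seteqP[W0 _].
have /WA/interior_subset/(_ W) [|w [Aw Ww]] := Wz; first exact: open_nbhs_nbhs.
exact: (W0 w).
Qed.

Lemma sub_nowhere_dense A B : A `<=` B -> nowhere_dense B -> nowhere_dense A.
Proof.
move=> AB /nowhere_denseP H; apply/nowhere_denseP => V oV V0.
have [W [oW W0 WV /seteqP[WB _]]] := H V oV V0; exists W; split=> //.
by apply/seteqP; split=> // z [Wz /AB Bz]; exact: (WB z).
Qed.

Lemma nowhere_dense_meager A : nowhere_dense A -> meager A.
Proof.
move=> ndA; exists (fun=> A) => //.
by apply/seteqP; split=> [x Ax|x [_ _]//]; exists 0%N.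
Qed.

Lemma sub_meager A B : A `<=` B -> meager B -> meager A.
Proof.
move=> AB [F ndF FB]; exists (fun n => F n `&` A).
  by move=> n; apply: sub_nowhere_dense (ndF n) => x [].
by rewrite -setI_bigcupl -FB setIC; apply/esym/setIidPl.
Qed.

Lemma meager0 : meager (set0 : set T).
Proof.
apply: nowhere_dense_meager; apply/nowhere_denseP => V oV V0.
by exists V; rewrite setI0; split.
Qed.

Lemma meager_bigcup (K : countType) (A : K -> set T) :
  (forall k, meager (A k)) -> meager (\bigcup_k A k).
Proof.
move=> mA.
have /choice[F HF] : forall k, exists F : nat -> set T,
    (forall n, nowhere_dense (F n)) /\ A k = \bigcup_n F n.
  by move=> k; have [F ? ?] := mA k; exists F.
exists (fun n => if unpickle n is Some kn then F kn.1 kn.2 else set0).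
  move=> n; case: unpickle => [[k m]|]; first by case: (HF k).
  by apply/nowhere_denseP => V oV V0; exists V; rewrite setI0; split.
apply/seteqP; split=> x.
  move=> [k _]; rewrite (HF k).2 => -[n _ Fx].
  by exists (pickle (k, n)) => //; rewrite pickleK.
move=> [n _]; case: unpickle => // -[k m] Fx; exists k => //.
by rewrite (HF k).2; exists m.
Qed.

Lemma meagerU A B : meager A -> meager B -> meager (A `|` B).
Proof.
move=> mA mB; apply: (@sub_meager _ (\bigcup_(b : bool) if b then A else B)).
  by move=> x [?|?]; [exists true|exists false].
by apply: meager_bigcup => -[].
Qed.

Lemma nonmeager_bigcup (K : countType) S (A : K -> set T) :
  S `<=` \bigcup_k A k -> ~ meager S -> exists k, ~ meager (A k).
Proof.
move=> SA nS; apply: contrapT => /forallNP nA; apply: nS.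
by apply: (sub_meager SA); apply: meager_bigcup => k; apply: contrapT; exact: nA.
Qed.

Lemma nonmeager_nonempty S : ~ meager S -> S !=set0.
Proof.
by move=> nS; apply/set0P/eqP => S0; apply: nS; rewrite S0; exact: meager0.
Qed.

Lemma open_frontier_nowhere_dense V : open V -> nowhere_dense (closure V `\` V).
Proof.
move=> oV; apply/nowhere_denseP => W oW [x Wx].
have [[y [Wy Vy]]|WV0] := pselect (W `&` V !=set0).
  exists (W `&` V); split; [exact: openI|by exists y|by move=> ? []|].
  by apply/seteqP; split=> // z [[_ ?] []].
exists W; split=> //; first by exists x.
apply/seteqP; split=> // z [Wz [/(_ W) []]]; first exact: open_nbhs_nbhs.
by move=> w [Vw Ww]; case: WV0; exists w.
Qed.

Section base.
Variables (K : countType) (U : K -> set T).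
Hypothesis baseU : open_base U.

(** Each such point lies in a basic open set in which [S] is meager, and there are only countably
    many of these. *)
Lemma meager_not_locally_nonmeager S :
  meager (S `&` ~` locally_nonmeager S).
Proof.
apply: (@sub_meager _ (\bigcup_k if `[< meager (S `&` U k) >] then S `&` U k
                               else set0)).
  move=> x [Sx /existsNP[V /not_implyP[oV /not_implyP[Vx /contrapT mSV]]]].
  have [k Ukx UkV] := baseU.2 _ _ oV Vx; exists k => //.
  case: asboolP => [_|]; first by split.
  by case; apply: sub_meager mSV => y [Sy /UkV].
by apply: meager_bigcup => k; case: asboolP => // _; exact: meager0.
Qed.

Lemma nonmeager_locally S : ~ meager S ->
  exists2 x, S x & locally_nonmeager S x.
Proof.
move=> nS; apply: contrapT => H; apply: nS.
apply: sub_meager (meager_not_locally_nonmeager S) => x Sx; split=> //.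
by move=> lx; apply: H; exists x.
Qed.

End base.

Lemma borel_baire_property S : borel S -> baire_property S.
Proof.
apply: smallest_sub; last first.
  move=> O oO; exists O => //; apply: sub_meager meager0 => x.
  by case=> -[].
split.
- by exists set0; [exact: open0|apply: sub_meager meager0 => x; case=> -[]].
(* Replacing the complement of [O] by that of [closure O] costs only the frontier of [O], which is
   nowhere dense. *)
- move=> A [ O oO mAO]; exists (~` closure O).
    by apply: closed_openC; exact: closed_closure.
  apply: (@sub_meager _ (((A `\` O) `|` (O `\` A)) `|` (closure O `\` O))).
    move=> x [[[_ nAx]]|[nOx]] /=.
      move=> /contrapT Ox; have [Ox'|Ox'] := pselect (O x); first by left; right.
      by right.
    move=> nn; have Ax : A x by apply: contrapT => Ax; apply: nn.
    by left; left; split=> // /subset_closure.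
  apply: meagerU => //; apply: nowhere_dense_meager.
  exact: open_frontier_nowhere_dense.
- move=> A BPA.
  have /choice[ O HO] : forall n, exists O,
      open O /\ meager ((A n `\` O) `|` (O `\` A n)).
    by move=> n; have [ O ? ?] := BPA n; exists O.
  exists (\bigcup_n O n); first by apply: bigcup_open => n _; case: (HO n).
  apply: (@sub_meager _ (\bigcup_n ((A n `\` O n) `|` (O n `\` A n)))).
    move=> x [[[n _ Ax] nO]|[[n _ Ox] nA]]; exists n => //.
      by left; split=> // Ox; apply: nO; exists n.
    by right; split=> // Ax; apply: nA; exists n.
  by apply: meager_bigcup => n; case: (HO n).
Qed.

Lemma nonmeager_baire_property S : baire_property S -> ~ meager S ->
  exists V, [/\ open V, V !=set0 & meager (V `\` S)].
Proof.
move=> [ O oO mO] nS; exists O; split=> //; last first.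
  by apply: sub_meager mO => x; right.
apply/set0P/eqP => O0; apply: nS; apply: sub_meager mO => x Sx.
by left; rewrite O0; split.
Qed.

Lemma borelD A B : borel A -> borel B -> borel (A `\` B).
Proof.
move=> bA bB; have [b0 bC bU] := @smallest_sigma_algebra T setT open.
have -> : A `\` B = ~` (\bigcup_n if n is 0%N then ~` A else B).
  apply/seteqP; split=> x.
    by move=> [Ax nB] [[|n] _] //; apply.
  move=> H; split; first by apply: contrapT => nA; apply: H; exists 0%N.
  by move=> Bx; apply: H; exists 1%N.
rewrite -setTD; apply: (bC); apply: bU => -[|n] //.
by rewrite -setTD; apply: bC.
Qed.

(** Were the difference nonmeager, the Baire property would make it comeager in some basic [U k],
    where [A] would be nonmeager and [B] meager. *)
Lemma meager_borelD (K : Type) (U : K -> set T) A B :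
  baire_space T -> open_base U -> borel A -> borel B ->
  (forall k, ~ meager (A `&` U k) -> ~ meager (B `&` U k)) ->
  meager (A `\` B).
Proof.
move=> bT bU bA bB AB; apply: contrapT => nAB.
have [V [oV [x Vx] mV]] :=
  nonmeager_baire_property (borel_baire_property (borelD bA bB)) nAB.
have [k Ukx UkV] := bU.2 _ _ oV Vx.
apply: (AB k).
  move=> mAU; apply: (bT _ (bU.1 k)); first by exists x.
  apply: sub_meager (meagerU mV mAU) => y Uy.
  have [Ay|Ay] := pselect (A y); first by right.
  by left; split; [exact: UkV|case].
by apply: sub_meager mV => y [By /UkV Vy]; split=> // -[].
Qed.

End meager.

Lemma meager_homeo (S T : topologicalType) (f : S -> T) (h : T -> S) (A : set T) :
  continuous f -> continuous h -> cancel f h -> cancel h f ->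
  meager A -> meager (f @^-1` A).
Proof.
move=> /continuousP cf /continuousP ch fK hK [F ndF ->].
rewrite preimage_bigcup; exists (fun n => f @^-1` F n) => // n.
apply/nowhere_denseP => V oV [x Vx].
have [||W [oW [y Wy] WV /seteqP[WF _]]] :=
    (nowhere_denseP (F n)).1 (ndF n) (h @^-1` V).
- exact: ch.
- by exists (f x); rewrite /= fK.
exists (f @^-1` W); split.
- exact: cf.
- by exists (h y); rewrite /= hK.
- by move=> z /WV; rewrite /= fK.
- by apply/seteqP; split=> // z [Wz Fz]; exact: (WF (f z)).
Qed.

(** * The Baire category theorem for complete metrics *)

Section metric.
Context {R : realType} {T : topologicalType} (d : T -> T -> R).
Hypotheses (dm : is_metric d) (dT : metrizes d).
Local Open Scope ring_scope.

Lemma metric_ball_open x r : open [set y | d x y < r].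
Proof.
case: dm => d0 dE dC dD; rewrite openE => y /= xy; rewrite /interior dT.
exists (r - d x y); first by rewrite /=; lra.
by move=> z /= yz; have := dD x y z; lra.
Qed.

Lemma metric_openP V x : open V -> V x ->
  exists2 e, 0 < e & [set y | d x y < e] `<=` V.
Proof.
move=> oV Vx; have : nbhs x V by exact: open_nbhs_nbhs.
by rewrite dT => -[e /= e0 eV]; exists e.
Qed.

Hypothesis dc : complete_metric d.

(** The limit a priori satisfies only [<=]; the strict nesting of consecutive balls improves this to
    [<]. *)
Lemma nested_balls (c : nat -> T) (r : nat -> R) :
  (forall n, 0 < r n) -> (forall e : R, 0 < e -> exists n, r n < e) ->
  (forall n, d (c n) (c n.+1) + r n.+1 < r n) ->
  exists l, forall n, d (c n) l < r n.
Proof.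
case: dm => d0 dE dC dD r0 rlim step.
have nest n m : d (c n) (c (n + m)%N) + r (n + m)%N <= r n.
  elim: m => [|m IH]; first by rewrite addn0 (dE _ _).2 // add0r.
  rewrite addnS; have := step (n + m)%N.
  by have := dD (c n) (c (n + m)%N) (c (n + m).+1); lra.
have nest' n m : (n <= m)%N -> d (c n) (c m) < r n.
  by move=> nm; have := nest n (m - n)%N; rewrite subnKC//; have := r0 m; lra.
have [|l cl] := @dc c.
  move=> e e0; have [|N rN] := rlim (e / 2); first lra.
  exists N => m n Nm Nn; have := nest' _ _ Nm; have := nest' _ _ Nn.
  by have := dD (c m) (c N) (c n); rewrite (dC (c m) (c N)); lra.
have le n : d (c n) l <= r n.
  rewrite leNgt; apply/negP => lt.
  have /cl : nbhs l [set y | d l y < d (c n) l - r n].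
    by rewrite dT; exists (d (c n) l - r n) => //=; lra.
  move=> [N _ HN]; have := HN (maxn n N); rewrite /= leq_maxr => /(_ isT).
  have := nest' n (maxn n N); rewrite leq_maxl => /(_ isT).
  by have := dD (c n) (c (maxn n N)) l; rewrite (dC (c (maxn n N)) l); lra.
exists l => n; have := le n.+1; have := step n.
by have := dD (c n) (c n.+1) l; lra.
Qed.

Lemma complete_metric_baire_space : baire_space T.
Proof.
move=> V oV [x0 Vx0] [F ndF VF].
case: (dm) => d0 dE dC dD.
pose P (n : nat) (p q : T * R) := [/\ 0 < q.2, q.2 < n.+1%:R^-1,
  d p.1 q.1 + q.2 < p.2 & [set y | d q.1 y < q.2] `&` F n = set0].
(* [choice] needs a value at every pair, so the radius condition sits under the existential and
   nonpositive radii get a dummy. *)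
have ext n (p : T * R) : exists q, 0 < p.2 -> P n p q.
  have [p0|] := pselect (0 < p.2); last by exists p.
  have [||W [oW [y Wy] WB WF]] :=
      (nowhere_denseP (F n)).1 (ndF n) [set y | d p.1 y < p.2].
  - exact: metric_ball_open.
  - by exists p.1 => /=; rewrite (dE _ _).2.
  have [e e0 eW] := metric_openP oW Wy.
  have := WB _ Wy => /= py.
  have n0 : (0 : R) < n.+1%:R^-1 by rewrite invr_gt0.
  pose s := Num.min e (Num.min (p.2 - d p.1 y) n.+1%:R^-1) / 2.
  have s0 : 0 < s by rewrite /s divr_gt0// !lt_min e0 n0 subr_gt0 py.
  have : s * 2 <= Num.min e (Num.min (p.2 - d p.1 y) n.+1%:R^-1).
    by rewrite /s -mulrA mulVf ?mulr1// pnatr_eq0.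
  rewrite !le_min => /and3P[s1 s2 s3].
  clearbody s; exists (y, s) => _; split=> /=.
  - by [].
  - by apply: lt_le_trans s3; rewrite ltr_pMr ?ltr1n.
  - lra.
  apply/seteqP; split=> // z [/= yz Fz].
  have : (W `&` F n) z by split=> //; apply: eW => /=; lra.
  by rewrite WF.
have /choice[f Hf] := fun np : nat * (T * R) => ext np.1 np.2.
have [e e0 eV] := metric_openP oV Vx0.
pose s := fix s n := if n is n'.+1 then f (n', s n') else (x0, e).
have s0 n : 0 < (s n).2.
  by elim: n => [|n IH] //=; have [] := Hf (n, s n) IH.
have sP n : P n (s n) (s n.+1) := Hf (n, s n) (s0 n).
have [||l Hl] := @nested_balls (fun n => (s n).1) (fun n => (s n).2) s0.
- move=> e' e'0; have [n ne] : exists n : nat, n.+1%:R^-1 < e'.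
    have [n _ Hn] := near_infty_natSinv_lt (PosNum e'0).
    by exists n; apply: Hn => /=.
  by exists n.+1; have [_ + _ _] := sP n; move=> /lt_trans; apply.
- by move=> n; have [] := sP n.
have : V l by apply: eV; exact: (Hl 0%N).
rewrite VF => -[n _ Fl].
have [_ _ _ /seteqP[+ _]] := sP n; move/(_ l); apply; split=> //.
exact: (Hl n.+1).
Qed.

End metric.

(** * Combinatorial presentation of quasi-Polish spaces *)

(* [P] codes the open subset [\bigcup_(F in P) [set a | [set` F] `<=` a]] of
   the powerset of [K]. *)
Definition code_holds (K : eqType) (a : set K) (P : set (seq K)) :=
  exists2 F, P F & [set` F] `<=` a.

(* [x |-> [set k | B k x]] is a homeomorphism from [T] onto the [Pi02] set of
   the [a] such that [code_holds a (P j) -> code_holds a (Q j)] for all [j]. *)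
Definition quasi_polish_coding (T : topologicalType) (K J : countType)
    (B : K -> set T) (P Q : J -> set (seq K)) :=
  [/\ forall k, open (B k),
      forall x V, open V -> V x -> exists2 F : seq K,
        [set` F] `<=` [set k | B k x] & \bigcap_(k in [set` F]) B k `<=` V,
      forall x y, (forall k, B k x <-> B k y) -> x = y
    & forall a : set K,
        (forall j, code_holds a (P j) -> code_holds a (Q j)) <->
        exists x, forall k, B k x <-> a k].

Section code_holds.
Context {K : eqType}.
Implicit Types (a b : set K) (P : set (seq K)).

Lemma sub_code_holds a b P : a `<=` b -> code_holds a P -> code_holds b P.
Proof. by move=> ab [F PF Fa]; exists F => // k /Fa/ab. Qed.

Lemma code_holds_set1 a F : code_holds a [set F] <-> [set` F] `<=` a.
Proof. by split=> [[_ -> //]|]; exists F. Qed.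

End code_holds.

Lemma sub_seq_directed (K : eqType) (F : nat -> seq K) (s : seq K) :
  (forall n, {subset F n <= F n.+1}) ->
  [set` s] `<=` [set k | exists n, k \in F n] ->
  exists N, forall n, (N <= n)%N -> {subset s <= F n}.
Proof.
move=> Fmon.
have Fle m n : (m <= n)%N -> {subset F m <= F n}.
  by move=> /subnKC <-; elim: (n - m)%N => [|i IH]; rewrite ?addn0 ?addnS // =>
    k /IH; exact: Fmon.
elim: s => [_|k s IH sF]; first by exists 0%N.
have [|N HN] := IH; first by move=> i /= si; apply: sF; rewrite /= inE si orbT.
have [|m Fm] := sF k; first by rewrite /= inE eqxx.
exists (maxn N m) => n; rewrite geq_max => /andP[Nn mn] i.
by rewrite inE => /predU1P[->|/HN]; [exact: Fle Fm|apply].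
Qed.

(** * Open sets of the powerset of [nat] *)

Section ptws_sierpinski.
Local Notation SN := {ptws nat -> sierpinski}.

Lemma open_ptws_sierpinskiP (W : set SN) (b : SN) : open W -> W b ->
  exists2 F : seq nat, [set` F] `<=` [set k | b k] &
    forall b' : SN, [set` F] `<=` [set k | b' k] -> W b'.
Proof.
move=> oW Wb.
(* The sets fixing finitely many true coordinates of [b] generate a filter, whose convergence to [b]
   is checked coordinate by coordinate. *)
pose base := filter_from [set F : seq nat | [set` F] `<=` [set k | b k]]
  (fun F => [set b' : SN | [set` F] `<=` [set k | b' k]]).
have baseF : Filter base.
  apply: filter_from_filter; first by exists [::].
  move=> F1 F2 bF1 bF2; exists (F1 ++ F2).
    by move=> k /=; rewrite mem_cat => /orP[/bF1|/bF2].
  by move=> b' Hb'; split=> k /= Fk;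
    apply: Hb'; rewrite /= mem_cat Fk ?orbT.
have : base --> b.
  apply/cvg_sup => i A [B [[N oN <-] /= Nb NA]].
  case bi : (b i).
    exists [:: i]; first by move=> k /=; rewrite inE => /eqP->.
    move=> b' /= Hb'; apply: NA => /=.
    have -> // : b' i = b i by rewrite bi; apply: Hb'; rewrite /= inE.
  (* An open subset of [sierpinski] containing [false] is everything, so a false coordinate imposes
     no condition. *)
  exists [::] => // b' _; apply: NA => /=; rewrite bi in Nb.
  by case: (b' i) => //; exact: oN.
move=> /(_ W) [|F bF FW]; first exact: open_nbhs_nbhs.
by exists F => // b' Hb'; exact: FW.
Qed.

Lemma open_ptws_sierpinski_coord n : open [set b : SN | b n].
Proof.
have cn : continuous (fun b : SN => b n).
  exact: (@proj_continuous nat (fun=> sierpinski) n).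
by have /(_ [set true]) := (continuousP _).1 cn; apply.
Qed.

Lemma open_code_holds (K : eqType) (p : K -> nat) (P : set (seq K)) :
  open [set b : SN | code_holds [set k | b (p k)] P].
Proof.
rewrite openE => b [F PF Fb]; rewrite /interior.
have : nbhs b [set b' : SN | [set` F] `<=` [set k | b' (p k)]].
  elim: F {PF} Fb => [_|k F IH Fb]; first exact: filterE.
  have nk : nbhs b [set b' : SN | b' (p k)].
    apply: open_nbhs_nbhs; split; first exact: open_ptws_sierpinski_coord.
    by apply: Fb; rewrite /= inE eqxx.
  have nF := IH (fun i Fi => Fb i (mem_behead (s := k :: F) Fi)).
  apply: filterS (filterI nk nF) => b' [bk bF] i /=.
  by rewrite inE => /predU1P[->//|/bF].
by apply: filterS => b' Fb'; exists F.
Qed.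

End ptws_sierpinski.

(** A [Pi02] set, as the complement of a union of differences of open sets, is cut out by
    implications between open sets; [code] turns each open set into finite lists of positive
    conditions. *)
Lemma quasi_polish_codingP (T : topologicalType) : quasi_polish T ->
  exists (B : nat -> set T) (P Q : nat -> set (seq nat)),
    quasi_polish_coding B P Q.
Proof.
move=> [A [[U [V [oU oV AE]]] [f [g [fK gK cf cg]]]]].
pose code (W : set {ptws nat -> sierpinski}) : set (seq nat) :=
  [set F | forall b : {ptws nat -> sierpinski},
     [set` F] `<=` [set k | b k] -> W b].
have codeP W (b : {ptws nat -> sierpinski}) : open W ->
    code_holds [set k | b k] (code W) <-> W b.
  move=> oW; split=> [[F FW Fb]|Wb]; first exact: FW.
  by have [F Fb FW] := open_ptws_sierpinskiP oW Wb; exists F.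
have cvf : continuous (fun x => set_val (f x)).
  move=> x; apply: continuous_comp; first exact: cf.
  exact: initial_continuous.
pose v x : {ptws nat -> sierpinski} := set_val (f x).
exists (fun k => [set x | v x k]), (fun n => code (U n)), (fun n => code (V n)).
split.
- move=> k; move/continuousP: cvf => /(_ [set b | b k]); apply.
  exact: open_ptws_sierpinski_coord.
- move=> x W oW Wx; move/continuousP: cg => /(_ W oW) [N oN NW].
  have Nx : N (v x).
    by rewrite /v -[N _]/((set_val @^-1` N) (f x)) NW /= fK.
  have [F Fx FN] := open_ptws_sierpinskiP oN Nx; exists F => // y Fy.
  have : (g @^-1` W) (f y) by rewrite -NW /=; apply: FN.
  by rewrite /= fK.
- move=> x y xy; rewrite -[x]fK -[y]fK; congr g; apply: val_inj.
  by apply: functional_extensionality_dep => k; apply/idP/idP => /xy.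
- move=> a; pose b : {ptws nat -> sierpinski} := fun k => `[< a k >].
  have ab : a = [set k | b k].
    by apply/seteqP; split=> k /= => [|/asboolP//]; move=> ?; apply/asboolP.
  split=> [H|[x Hx] n].
    have Ab : A b.
      apply: contrapT => nA; have : (~` A) b by [].
      rewrite AE => -[n _ [/codeP - /(_ (oU n)) Ub nV]]; apply: nV.
      by apply/codeP => //; rewrite -ab; apply: H; rewrite ab.
    exists (g (exist _ b (mem_set Ab))) => k.
    by rewrite /= /v gK ab.
  have -> : a = [set k | v x k] by apply/seteqP; split=> k /Hx.
  rewrite !codeP // => Uv; apply: contrapT => nV.
  have : (~` A) (v x) by rewrite AE; exists n.
  by apply; rewrite /v; exact: set_valP.
Qed.

Lemma quasi_polish_coding_quasi_polish (T : topologicalType) (K J : countType)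
    (B : K -> set T) (P Q : J -> set (seq K)) :
  quasi_polish_coding B P Q -> quasi_polish T.
Proof.
move=> [oB baseB sepB solB].
pose SN := {ptws nat -> sierpinski}.
(* The second clause forbids true values outside the range of [pickle], which need not be all of
   [nat]. *)
pose A : set SN :=
  [set b | (forall j, code_holds [set k | b (pickle k)] (P j) ->
                      code_holds [set k | b (pickle k)] (Q j)) /\
           (forall n, b n -> exists k : K, pickle k = n)].
pose v x : SN := fun n => `[< exists2 k, pickle k = n & B k x >].
have vE x k : v x (pickle k) <-> B k x.
  split=> [/asboolP[k' /(pcan_inj pickleK) -> //]|Bx].
  by apply/asboolP; exists k.
have vtrace x : [set k | v x (pickle k)] = [set k | B k x].
  by apply/seteqP; split=> k /= /vE.
have Av x : A (v x).
  split; first by rewrite vtrace; apply/solB; exists x.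
  by move=> n /asboolP[k <- _]; exists k.
have /choice[h Hh] : forall b : set_type A, exists x, v x = \val b.
  move=> b; have [/solB[x Hx] bn] := set_valP b.
  exists x; apply: functional_extensionality_dep => n; apply/idP/idP.
    by move=> /asboolP[k <- /Hx].
  by move=> bn1; have [k kn] := bn _ bn1; apply/asboolP; exists k => //;
    apply/Hx; rewrite /= kn.
pose f x : set_type A := exist _ (v x) (mem_set (Av x)).
exists A; split.
  (* Differences covering the complement of [A]: [inl j] collects the failures of condition [j],
     [inr n] the points true at an [n] outside the range of [pickle]. *)
  exists (fun n => match unpickle n : option (J + nat) with
    | Some (inl j) => [set b : SN | code_holds [set k | b (pickle k)] (P j)]
    | Some (inr n) =>
        if `[< exists k : K, pickle k = n >] then set0 else [set b : SN | b n]
    | None => set0 end).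
  exists (fun n => match unpickle n : option (J + nat) with
    | Some (inl j) => [set b : SN | code_holds [set k | b (pickle k)] (Q j)]
    | _ => set0 end).
  split.
  - move=> n; case: unpickle => [[j|m]|]; [exact: open_code_holds| |exact: open0].
    by case: ifP => _; [exact: open0|exact: open_ptws_sierpinski_coord].
  - by move=> n; case: unpickle => [[j|m]|]; [exact: open_code_holds|exact: open0..].
  apply/seteqP; split=> b.
    move=> /not_andP[/existsNP[j /not_implyP[Pj Qj]]|
                     /existsNP[n /not_implyP[bn nk]]].
      by exists (pickle (inl j : J + nat)%type) => //; rewrite pickleK.
    exists (pickle (inr n : J + nat)%type) => //; rewrite pickleK.
    by case: asboolP => // _; split.
  move=> [n _]; case: unpickle => [[j|m]|]; last by case.
    by move=> [Pj nQj] [/(_ j Pj)].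
  case: asboolP => [_ []//|nk [bm _] [_ bK]].
  by apply: nk; exact: bK.
exists f, h; split.
- by move=> x; apply: sepB => k; rewrite -!vE Hh.
- by move=> b; apply: val_inj; rewrite /= Hh.
- apply/continuousP => _ [W oW <-]; rewrite openE => x /= Wx.
  have [F Fx FW] := open_ptws_sierpinskiP oW Wx.
  have : nbhs x [set y | [set` F] `<=` [set n | v y n]].
    elim: F Fx {FW} => [_|n F IH Fx]; first exact: filterE.
    have /asboolP[k kn Bkx] : v x n by apply: Fx; rewrite /= inE eqxx.
    have nk : nbhs x (B k) by exact: open_nbhs_nbhs.
    have nF := IH (fun i Fi => Fx i (mem_behead (s := n :: F) Fi)).
    apply: filterS (filterI nk nF) => y [By yF] i /=.
    by rewrite inE => /predU1P[->|/yF//]; apply/asboolP; exists k.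
  by apply: filterS => y; exact: FW.
- apply/continuousP => V oV.
  exists [set b : SN | code_holds [set k | b (pickle k)]
            [set F : seq K | \bigcap_(k in [set` F]) B k `<=` V]].
    exact: open_code_holds.
  apply/seteqP; split=> b /=; rewrite -[set_val b]Hh vtrace.
    by move=> [F FV Fb]; apply: FV.
  by move=> Vb; have [F ? ?] := baseB _ _ oV Vb; exists F.
Qed.

(** * Vaught transforms *)

Section topological_group.
Context {G : topologicalGroupType}.

Lemma mulg_continuousr (g : G) : continuous (fun h : G => (g * h)%g).
Proof.
move=> h; apply: (@continuous_comp _ _ _ (fun h => (g, h)) (fun p => p.1 * p.2)%g).
  by apply: cvg_pair => //=; exact: cvg_cst.
exact: mulg_continuous.
Qed.

Lemma open_translate (g : G) (U : set G) : open U -> open [set h | U (g * h)%g].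
Proof. by move: U; apply/continuousP/mulg_continuousr. Qed.

Lemma open_mulg (U : set G) (g h : G) : open U -> U (g * h)%g ->
  exists V W, [/\ open V, open W, V g, W h &
    forall v w, V v -> W w -> U (v * w)%g].
Proof.
move=> oU Ugh; have : nbhs (g * h)%g U by exact: open_nbhs_nbhs.
move=> /(@mulg_continuous G (g, h)) [[V W] /= [nV nW] VW].
exists V°, W°; split; [exact: open_interior|exact: open_interior|by []|by []|].
move=> v w /interior_subset Vv /interior_subset Ww.
exact: (VW (v, w)).
Qed.

Lemma meager_translate (g : G) (A : set G) :
  meager [set h | A (g * h)%g] <-> meager A.
Proof.
have tr k B : meager B -> meager [set h : G | B (k * h)%g].
  apply: (@meager_homeo _ _ (fun h => k * h)%g (fun h => k^-1 * h)%g);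
    [exact: mulg_continuousr|exact: mulg_continuousr|exact: mulKg|exact: mulVKg].
split=> [/(tr g^-1%g)|]; last exact: tr.
by apply: sub_meager => h /=; rewrite mulVKg.
Qed.

End topological_group.

Section vaught.
Context {G : topologicalGroupType} {X : Type} (alpha : G * X -> X).
Hypothesis alphaA : left_action alpha.
Implicit Types (g h : G) (x y : X) (U V W : set G) (A B : set X).

Definition return_set A x : set G := [set g | A (alpha (g^-1%g, x))].

Lemma actK g : cancel (fun x => alpha (g, x)) (fun x => alpha (g^-1%g, x)).
Proof. by move=> x; rewrite -alphaA.2 mulVg alphaA.1. Qed.

Lemma actVK g : cancel (fun x => alpha (g^-1%g, x)) (fun x => alpha (g, x)).
Proof. by move=> x; rewrite -alphaA.2 mulgV alphaA.1. Qed.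

Lemma vaughtE U A x : vaught alpha U A x <-> ~ meager (return_set A x `&` U).
Proof.
rewrite /vaught /=; set S := [set g | _]; suff -> : S = return_set A x `&` U by [].
apply/seteqP; split=> g.
  by move=> [Ug [a Aa <-]]; split=> //; rewrite /return_set /= actK.
by move=> [Ag Ug]; split=> //; exists (alpha (g^-1%g, x)); rewrite // actVK.
Qed.

Lemma sub_vaught U V A B : U `<=` V -> A `<=` B ->
  vaught alpha U A `<=` vaught alpha V B.
Proof.
move=> UV AB x /vaughtE nU; apply/vaughtE => mV; apply: nU.
by apply: sub_meager mV => g [/AB Ag /UV].
Qed.

(** The return set of [alpha (g, x)] is the left translate by [g] of that of [x], and translations
    preserve meagerness. *)
Lemma vaught_act U A g x :
  vaught alpha U A (alpha (g, x)) <-> vaught alpha [set h | U (g * h)%g] A x.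
Proof.
rewrite !vaughtE -(meager_translate g).
suff -> : [set h | (return_set A (alpha (g, x)) `&` U) (g * h)%g] =
    return_set A x `&` [set h | U (g * h)%g] by [].
by apply/seteqP; split=> h [Ah Uh]; split=> //;
  move: Ah; rewrite /return_set /= -alphaA.2 invgM mulgVK.
Qed.

Lemma vaught_hit U A x : vaught alpha U A x ->
  exists2 g, U g & A (alpha (g^-1%g, x)).
Proof. by move=> /vaughtE/nonmeager_nonempty[g [Ag Ug]]; exists g. Qed.

Lemma locally_nonmeager_vaught U A x g : open U -> U g ->
  locally_nonmeager (return_set A x) g -> vaught alpha U A x.
Proof. by move=> oU Ug lg; apply/vaughtE; exact: lg. Qed.

Section countable_base.
Variables (K : countType) (UU : K -> set G).
Hypothesis baseU : open_base UU.

Lemma vaught_locally U A x : open U -> vaught alpha U A x ->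
  exists g, [/\ U g, A (alpha (g^-1%g, x)) & locally_nonmeager (return_set A x) g].
Proof.
move=> oU /vaughtE /(nonmeager_locally baseU)[g [Ag Ug] lg].
exists g; split=> // V oV Vg mV; apply: (lg V oV Vg).
by apply: sub_meager mV => h [[? _] ?].
Qed.

(** Let [k] in [U] be a point of local nonmeagerness. Continuity of multiplication at [(g, g^-1 k)]
    gives [W] around [g] and [C] around [g^-1 k] with [W C] inside [U]. *)
Lemma vaught_act_nbhs U A g x : open U -> vaught alpha U A (alpha (g, x)) ->
  exists W C, [/\ open W, W g, open C, vaught alpha C A x &
    forall w y, W w -> vaught alpha C A y -> vaught alpha U A (alpha (w, y))].
Proof.
move=> oU /(vaught_locally oU)[k [Uk _ lk]].
have [|W [C [oW oC Wg Ck WC]]] := @open_mulg _ U g (g^-1 * k)%g oU.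
  by rewrite mulVKg.
exists W, C; split=> //.
  (* Seen as a double translate, [C] turns the goal into a transform at [alpha (g, x)] over a
     neighbourhood of [k]. *)
  have -> : C = [set h | C (g^-1 * (g * h))%g].
    by apply/seteqP; split=> h /=; rewrite mulKg.
  apply/(vaught_act [set h | C (g^-1 * h)%g]).
  by apply: locally_nonmeager_vaught lk => //; exact: open_translate.
move=> w y Ww Cy; apply/vaught_act.
by apply: sub_vaught Cy => // c Cc; exact: WC.
Qed.

End countable_base.

End vaught.

Lemma continuous_borel_map (S T : topologicalType) (f : S -> T) :
  continuous f -> borel_map f.
Proof.
move=> /continuousP cf; rewrite /borel_map; apply: smallest_sub; last first.
  by move=> V oV; apply: sub_sigma_algebra; exact: cf.
have [b0 bC bU] := @smallest_sigma_algebra S setT open.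
split=> [|A bA|A bA]; rewrite /borel /=.
- by rewrite preimage_set0.
- by rewrite setTD preimage_setC -setTD; exact: bC.
- by rewrite preimage_bigcup; exact: bU.
Qed.

(** * The topology generated by the Vaught transforms *)

Section vaught_topology.
Context {G : topologicalGroupType} {X : topologicalType} (alpha : G * X -> X).
Hypothesis alphaA : left_action alpha.
Variables (K L : countType) (UU : K -> set G) (AA : L -> set X).
Hypotheses (baseU : open_base UU) (baseA : open_base AA).
Hypothesis baireG : baire_space G.
Implicit Types (g h : G) (x y : X) (U V W : set G) (A B : set X).

Local Notation OGOX := (vaught_unions alpha open open).

(** The nonmeager witness set is covered by countably many pieces, one for each pair of basic sets
    inside [U] and [A]; some piece is nonmeager. *)
Lemma vaught_base U A x : open U -> open A -> vaught alpha U A x ->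
  exists k l, [/\ UU k `<=` U, AA l `<=` A & vaught alpha (UU k) (AA l) x].
Proof.
move=> oU oA /(vaughtE alphaA) nUA.
pose S (kl : K * L) := if `[< UU kl.1 `<=` U /\ AA kl.2 `<=` A >] then
  return_set alpha (AA kl.2) x `&` UU kl.1 else set0.
have [|[k l]] := @nonmeager_bigcup _ _ _ S _ nUA.
  move=> g [Ag Ug]; have [k Uk kU] := baseU.2 _ _ oU Ug.
  have [l Al lA] := baseA.2 _ _ oA Ag; exists (k, l) => //.
  by rewrite /S; case: asboolP => [_|[]] //; split.
rewrite /S; case: asboolP => [[kU lA]|_] /= nS; last by case: nS; exact: meager0.
by exists k, l; split=> //; apply/(vaughtE alphaA).
Qed.

(** Basic transforms suffice and are countably many, so countable unions give the same family as
    arbitrary ones. *)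
Lemma vaught_unionsP B : OGOX B <->
  forall x, B x -> exists U A,
    [/\ open U, open A, vaught alpha U A x & vaught alpha U A `<=` B].
Proof.
split=> [[I [U [A [oU oA ->]]]] x [i Ii Bx]|HB].
  by exists (U i), (A i); split; [exact: oU|exact: oA| |move=> y ?; exists i].
exists [set n | exists k l, unpickle n = Some (k, l) /\
                       vaught alpha (UU k) (AA l) `<=` B].
exists (fun n => if (unpickle n : option (K * L)) is Some (k, l)
                 then UU k else set0).
exists (fun n => if (unpickle n : option (K * L)) is Some (k, l)
                 then AA l else set0).
split.
- by move=> n [k [l [-> _]]]; exact: baseU.1.
- by move=> n [k [l [-> _]]]; exact: baseA.1.
apply/seteqP; split=> x.
  move=> /HB[U [A [oU oA Ux UB]]].
  have [k [l [kU lA xkl]]] := vaught_base oU oA Ux.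
  exists (pickle (k, l)); last by rewrite pickleK.
  exists k, l; rewrite pickleK; split=> // y ykl; apply: UB.
  exact: (sub_vaught alphaA) ykl.
by move=> [n [k [l [-> klB]]] /klB].
Qed.

Lemma vaught_in_unions U A : open U -> open A -> OGOX (vaught alpha U A).
Proof. by move=> oU oA; apply/vaught_unionsP => x Ux; exists U, A; split. Qed.

Lemma vaught_contains U A x g : open U -> U g ->
  (forall h, U h -> A (alpha (h^-1%g, x))) -> vaught alpha U A x.
Proof.
move=> oU Ug UA; apply/(vaughtE alphaA) => mA; apply: (baireG oU).
  by exists g.
by apply: sub_meager mA => h Uh; split=> //; exact: UA.
Qed.

Lemma vaught_unions_act_nbhs B g x : OGOX B -> B (alpha (g, x)) ->
  exists W C, [/\ open W, W g, OGOX C, C x &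
    forall w y, W w -> C y -> B (alpha (w, y))].
Proof.
move=> /vaught_unionsP HB /HB[U [A [oU oA Ux UB]]].
have [W [C [oW Wg oC Cx WC]]] := vaught_act_nbhs alphaA baseU oU Ux.
exists W, (vaught alpha C A); split=> //; first exact: vaught_in_unions.
by move=> w y Ww Cy; exact/UB/WC.
Qed.

Section open_vaught.
Hypothesis openV : OGOX `<=` open.

(* For the intersection: small group elements move x inside the open set
   [C1 `&` C2], and move [C1 `&` C2] into B1 and B2; hence x belongs to
   [W * (C1 `&` C2)], which is contained in [B1 `&` B2]. *)
Lemma vaught_unions_topology : is_topology OGOX.
Proof.
split.
- apply/vaught_unionsP => x _; exists setT, setT.
  split=> //; [exact: openT|exact: openT|].
  by apply: (@vaught_contains _ _ _ 1%g) => //; exact: openT.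
- move=> B1 B2 oB1 oB2; apply/vaught_unionsP => x [B1x B2x].
  have x1 : x = alpha (1%g, x) by rewrite alphaA.1.
  rewrite x1 in B1x B2x.
  have [W1 [C1 [oW1 W11 oC1 C1x WC1]]] := vaught_unions_act_nbhs oB1 B1x.
  have [W2 [C2 [oW2 W21 oC2 C2x WC2]]] := vaught_unions_act_nbhs oB2 B2x.
  rewrite x1 in C1x C2x.
  have [N1 [D1 [oN1 N11 _ D1x ND1]]] := vaught_unions_act_nbhs oC1 C1x.
  have [N2 [D2 [oN2 N21 _ D2x ND2]]] := vaught_unions_act_nbhs oC2 C2x.
  have /continuousP cinv := @invg_continuous G.
  pose W := (W1 `&` W2) `&` ((fun g => g^-1%g) @^-1` (N1 `&` N2)).
  have oW : open W.
    by apply: openI; [exact: openI|apply: cinv; exact: openI].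
  exists W, (C1 `&` C2); split=> //.
  + by apply: openI; exact: openV.
  + apply: (@vaught_contains _ _ _ 1%g) => //; first by rewrite /W /= invg1.
    by move=> h [_ [N1h N2h]]; split; [exact: ND1|exact: ND2].
  + move=> y /(vaught_hit alphaA)[g [[W1g W2g] _] [C1y C2y]].
    by rewrite -(actVK alphaA g y); split; [exact: WC1|exact: WC2].
- move=> F FO; apply/vaught_unionsP => x [B FB Bx].
  have /FO/vaught_unionsP/(_ x Bx)[U [A [oU oA Ux UB]]] := FB.
  by exists U, A; split=> // y /UB By; exists B.
Qed.

Lemma vaught_unions_continuous (topO : is_topology OGOX) :
  continuous (alpha : G * topologized topO -> topologized topO).
Proof.
move=> [g x] N [B [oB Bx BN]].
have [W [C [oW Wg oC Cx WC]]] := vaught_unions_act_nbhs oB Bx.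
exists (W, C) => /=.
  split; first exact: open_nbhs_nbhs.
  by exists C; split.
by move=> [w y] /= [Ww Cy]; apply: BN; exact: WC.
Qed.

End open_vaught.

(** Return sets of open sets are now open, so in the Baire space [G] they meet an open [U] in a
    nonmeager set as soon as they meet it. *)
Lemma continuous_vaught_unions : continuous alpha -> OGOX = open.
Proof.
move=> calpha.
have oret A x : open A -> open (return_set alpha A x).
  move=> oA; suff /continuousP : continuous (fun g => alpha (g^-1%g, x)).
    by apply.
  move=> g; apply: (@continuous_comp _ _ _ (fun g => (g^-1%g, x)) alpha).
    by apply: cvg_pair; [exact: invg_continuous|exact: cvg_cst].
  exact: calpha.
apply/seteqP; split=> B.
  move=> /vaught_unionsP HB; rewrite openE => x /HB[U [A [oU oA]]].
  move=> /(vaught_hit alphaA)[g Ug Ag] UB.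
  have nA : nbhs (alpha (g^-1%g, x)) A by exact: open_nbhs_nbhs.
  have [[V W] /= [nV nW] VW] := calpha (g^-1%g, x) A nA.
  apply: filterS nW => y Wy; apply: UB; apply/(vaughtE alphaA) => mA.
  apply: baireG mA; first by apply: openI => //; exact: oret.
  exists g; split=> //; apply: (VW (_, _)).
  by split=> //=; exact: nbhs_singleton.
move=> oB; apply/vaught_unionsP => x Bx.
have nB : nbhs (alpha (1%g, x)) B by rewrite alphaA.1; exact: open_nbhs_nbhs.
have [[V W] /= [nV nW] VW] := calpha (1%g, x) B nB.
exists V°, W°; split; [exact: open_interior|exact: open_interior| |].
  apply/(vaughtE alphaA) => mA; apply: baireG mA.
    by apply: openI; [apply: oret; exact: open_interior|exact: open_interior].
  by exists 1%g; split=> //; rewrite /return_set /= invg1 alphaA.1.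
move=> y /(vaught_hit alphaA)[g /interior_subset Vg /interior_subset Wy].
by rewrite -(actVK alphaA g y); apply: (VW (_, _)).
Qed.

Lemma borel_return_set A x : borel_map alpha -> open A ->
  borel (return_set alpha A x).
Proof.
move=> balpha oA.
have : borel_map (fun g : G => (g^-1%g, x)).
  apply: continuous_borel_map => g.
  by apply: cvg_pair; [exact: invg_continuous|exact: cvg_cst].
by move=> /(_ (alpha @^-1` A)); apply; apply: balpha; exact: sub_sigma_algebra.
Qed.

(** For each [l] the return sets of [AA l] at [x] and [y] differ by a meager set. Some [g] avoids
    all these differences, and then [g^-1 x] and [g^-1 y] lie in the same basic sets. *)
Lemma vaught_separates x y : borel_map alpha ->
  (forall x' y', (forall l, AA l x' <-> AA l y') -> x' = y') ->
  (forall k l, vaught alpha (UU k) (AA l) x <-> vaught alpha (UU k) (AA l) y) ->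
  x = y.
Proof.
move=> balpha sepA xy.
have mD x' y' l :
    (forall k, vaught alpha (UU k) (AA l) x' -> vaught alpha (UU k) (AA l) y') ->
    meager (return_set alpha (AA l) x' `\` return_set alpha (AA l) y').
  move=> xy'; apply: (meager_borelD baireG baseU).
  - by apply: borel_return_set => //; exact: baseA.1.
  - by apply: borel_return_set => //; exact: baseA.1.
  - by move=> k /(vaughtE alphaA)/xy'/(vaughtE alphaA).
pose D l := (return_set alpha (AA l) x `\` return_set alpha (AA l) y) `|`
            (return_set alpha (AA l) y `\` return_set alpha (AA l) x).
have mDl : meager (\bigcup_l D l).
  by apply: meager_bigcup => l; apply: meagerU; apply: mD => k /xy.
have [g nDg] : exists g, ~ (\bigcup_l D l) g.
  apply: contrapT => /forallNP all; apply: (baireG (@openT G)).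
    by exists 1%g.
  by apply: sub_meager mDl => g _; apply: contrapT => /all.
rewrite -(actVK alphaA g x) -(actVK alphaA g y); congr (alpha (_, _)).
apply: sepA => l; split=> Al; apply: contrapT => nAl; apply: nDg; exists l => //.
  by left.
by right.
Qed.

End vaught_topology.

(** * Quasi-Polishness of the coarser topology *)

Section good_points.
Context {G : topologicalGroupType} {X : topologicalType} (alpha : G * X -> X).
Hypothesis alphaA : left_action alpha.
Variables (K L : countType) (UU : K -> set G) (AA : L -> set X).
Hypotheses (baseU : open_base UU) (baseA : open_base AA).
Implicit Types (g h : G) (x y : X) (U : set G) (A : set X).

(* The image of [U `*` (A `&` good_point)] under the action is exactly [U * A]
   (see vaught_hit_good and good_vaught), so the action is an open map from
   [G * good_point] onto X equipped with the topology of the [U * A]. *)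
Definition good_point x :=
  forall k l, UU k 1%g -> AA l x -> vaught alpha (UU k) (AA l) x.

(** If [g^-1 x] is not good because of [AA l], translating by [g] shows that the return set of
    [AA l] contains [g] but is not locally nonmeager there. *)
Lemma good_point_generic x :
  meager [set g | ~ good_point (alpha (g^-1%g, x))].
Proof.
pose S l := return_set alpha (AA l) x.
apply: (@sub_meager _ _ (\bigcup_l (S l `&` ~` locally_nonmeager (S l)))).
  move=> g /existsNP[k /existsNP[l /not_implyP[Uk1 /not_implyP[Alg nV]]]].
  exists l => //; split=> // lg; apply: nV; apply/(vaught_act alphaA).
  apply: locally_nonmeager_vaught lg => //; first exact/open_translate/baseU.1.
  by rewrite /= mulVg.
apply: meager_bigcup => l; exact: meager_not_locally_nonmeager baseU _.
Qed.

Lemma vaught_hit_good U A x : vaught alpha U A x ->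
  exists g, [/\ U g, A (alpha (g^-1%g, x)) & good_point (alpha (g^-1%g, x))].
Proof.
move=> /(vaughtE alphaA) nUA; apply: contrapT => /forallNP H; apply: nUA.
apply: sub_meager (good_point_generic x) => g [Ag Ug] gg.
by apply: (H g).
Qed.

Lemma good_vaught U A g x : open U -> U g -> open A -> A x -> good_point x ->
  vaught alpha U A (alpha (g, x)).
Proof.
move=> oU Ug oA Ax gx; apply/(vaught_act alphaA).
have [|k Uk kU] := baseU.2 1%g _ (open_translate g oU).
  by rewrite /= mulg1.
have [l Al lA] := baseA.2 _ _ oA Ax.
exact: (sub_vaught alphaA kU lA) (gx k l Uk Al).
Qed.

End good_points.

(** * A coding of the coarser topology by chains of basic sets *)

Section vaught_quasi_polish.
Context {R : realType} {G : topologicalGroupType} {X : topologicalType}.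
Variables (alpha : G * X -> X) (d : G -> G -> R) (c : nat -> G).
Variables (B : nat -> set X) (P Q : nat -> set (seq nat)).
Hypotheses (dm : is_metric d) (dG : metrizes d) (dc : complete_metric d).
Hypothesis c_dense : forall V : set G, open V -> V !=set0 -> exists i, V (c i).
Hypothesis codeX : quasi_polish_coding B P Q.
Hypotheses (alphaA : left_action alpha) (balpha : borel_map alpha).

Local Notation OGOX := (vaught_unions alpha open open).

(** With radii of the form [1 / (n + 1)], a lower bound on the second index is an upper bound on the
    radius. *)
Definition rational_ball (k : nat * nat) : set G :=
  [set g | d (c k.1) g < k.2.+1%:R^-1]%R.

Definition basic_open (F : seq nat) : set X := \bigcap_(i in [set` F]) B i.

(** The inequality between centres and radii is the nesting hypothesis of [nested_balls]. *)
Lemma rational_ball_shrink (k : nat * nat) g W n : rational_ball k g ->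
  open W -> W g -> exists k', [/\ (n <= k'.2)%N,
    (d (c k.1) (c k'.1) + k'.2.+1%:R^-1 < k.2.+1%:R^-1)%R,
    rational_ball k' g & rational_ball k' `<=` W].
Proof.
rewrite /rational_ball /=; move: (k.2.+1%:R^-1)%R => r kg oW Wg.
have [e e0 eW] := metric_openP dG oW Wg.
case: (dm) => d0 dE dC dD.
(* Half of the available room, because a new radius is spent twice: from [g] to the new centre and
   from there to the edge of the new ball. *)
pose s := (Num.min e (r - d (c k.1) g) / 2)%R.
have s0 : (0 < s)%R by rewrite /s divr_gt0// lt_min e0 subr_gt0 kg.
have : (s * 2 <= Num.min e (r - d (c k.1) g))%R.
  by rewrite /s -mulrA mulVf ?mulr1// pnatr_eq0.
rewrite le_min => /andP[se sr]; clearbody s.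
have [N _ HN] := near_infty_natSinv_lt (PosNum s0).
have /= := HN (maxn n N) (leq_maxr _ _).
have : (0 < (maxn n N).+1%:R^-1 :> R)%R by rewrite invr_gt0.
have := leq_maxl n N.
move: (maxn n N) => m nm t0 ts.
have [|i ig] := c_dense (metric_ball_open dm dG g m.+1%:R^-1%R).
  by exists g; rewrite /= (dE _ _).2.
exists (i, m); move: t0 ts ig => /=; move: (m.+1%:R^-1)%R => t t0 ts ig.
split=> //.
- by have := dD (c k.1) g (c i); lra.
- by rewrite dC.
- by move=> h /= ih; apply: eW => /=; have := dD g (c i) h; lra.
Qed.

Lemma rational_ball_base : open_base rational_ball.
Proof.
split=> [k|g V oV Vg]; first exact: (metric_ball_open dm dG (c k.1)).
have [|i gi] := c_dense (metric_ball_open dm dG g 1%R).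
  by exists g; case: dm => _ dE _ _; rewrite /= (dE _ _).2.
have [|k [_ _ kg kV]] := @rational_ball_shrink (i, 0%N) g V 0 _ oV Vg.
  by rewrite /rational_ball /= invr1; case: dm => _ _ -> _.
by exists k.
Qed.

Lemma basic_open_base : open_base basic_open.
Proof.
case: codeX => oB baseB _ _; split=> [F|x V oV Vx]; last first.
  by have [F ? ?] := baseB _ _ oV Vx; exists F.
rewrite /basic_open openE => x Fx; rewrite /interior.
elim: F Fx => [_|i F IH Fx]; first by apply: filterE => y k.
have ni : nbhs x (B i).
  by apply: open_nbhs_nbhs; split=> //; apply: Fx; rewrite /= inE eqxx.
have nF := IH (fun k Fk => Fx k (mem_behead (s := i :: F) Fk)).
apply: filterS (filterI ni nF) => y [yi yF] k /=.
by rewrite inE => /predU1P[->//|/yF].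
Qed.

Lemma basic_open_separates x y :
  (forall F, basic_open F x <-> basic_open F y) -> x = y.
Proof.
case: codeX => _ _ sepB _ xy; apply: sepB => k.
have b1 z : basic_open [:: k] z <-> B k z.
  split=> [|Bz i /=]; first by apply; rewrite /= inE.
  by rewrite inE => /eqP->.
by rewrite -!b1.
Qed.

Hypothesis openV : OGOX `<=` open.

Local Notation good := (good_point alpha rational_ball basic_open).

(* The left summand carves out X, the right summand its good points. *)
Definition good_P (j : nat + (nat * nat) * seq nat) : set (seq nat) :=
  match j with
  | inl i => P i
  | inr (k, F) => [set F' | F' = F /\ rational_ball k 1%g]
  end.

Definition good_Q (j : nat + (nat * nat) * seq nat) : set (seq nat) :=
  match j with
  | inl i => Q i
  | inr (k, F) =>
      [set F' | basic_open F' `<=` vaught alpha (rational_ball k) (basic_open F)]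
  end.

(** The transforms being open in [X], goodness is a countable family of implications between open
    conditions, hence [Pi02]. *)
Lemma good_pointP x : good x <->
  forall j, code_holds [set i | B i x] (good_P j) ->
            code_holds [set i | B i x] (good_Q j).
Proof.
split=> [gx [i|[k F]]|H k F k1 Fx].
- by case: codeX => _ _ _ /(_ [set i | B i x]) [_] /=; apply; exists x.
- move=> [_ [-> k1] Fx] /=.
  have vx := gx k F k1 Fx.
  have [|F' Fx' F'V] := basic_open_base.2 _ _ _ vx; last by exists F'.
  apply: openV.
  apply: (vaught_in_unions alphaA rational_ball_base basic_open_base).
    exact: rational_ball_base.1.
  exact: basic_open_base.1.
- have [|F' F'V Fx'] := H (inr (k, F)); last exact: F'V.
  by exists F.
Qed.

(** Induction on [n]: a condition triggered by [F] has its conclusion witnessed at [x] by finitely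
    many indices, which are appended. Only triggers from the original [F] count, so the added
    indices create no new obligations. *)
Lemma good_code_extend x F n : good x -> basic_open F x ->
  exists F', [/\ {subset F <= F'}, basic_open F' x &
    forall j, (pickle j < n)%N -> code_holds [set` F] (good_P j) ->
              code_holds [set` F'] (good_Q j)].
Proof.
move=> /good_pointP gx Fx; elim: n => [|n [F' [FF' Fx' HF']]].
  by exists F; split.
have catx F1 F2 : basic_open F1 x -> basic_open F2 x -> basic_open (F1 ++ F2) x.
  by move=> h1 h2 i /=; rewrite mem_cat => /orP[/h1|/h2].
have subl F1 F2 : [set` F1] `<=` [set` (F1 ++ F2 : seq nat)].
  by move=> i /= Fi; rewrite mem_cat Fi.
have [[j [jn jP]]|nj] := pselect (exists j, pickle j = n /\
    code_holds [set` F] (good_P j)).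
  have [|F1 QF1 F1x] := gx j; first exact: sub_code_holds jP.
  exists (F' ++ F1); split.
  - by move=> i /FF' Fi; rewrite mem_cat Fi.
  - exact: catx.
  move=> j'; rewrite ltnS leq_eqVlt => /predU1P[j'n _|/HF' H /H].
    have -> : j' = j by apply: (pcan_inj pickleK); rewrite jn.
    by exists F1 => // i /= Fi; rewrite mem_cat Fi orbT.
  exact: sub_code_holds.
exists F'; split=> // j'; rewrite ltnS leq_eqVlt => /predU1P[j'n jP|/HF' H]; last exact: H.
by case: nj; exists j'.
Qed.

Local Notation index := ((nat * nat) * seq nat)%type.

Definition vaught_basic (t : index) : set X :=
  vaught alpha (rational_ball t.1) (basic_open t.2).

(** One step of a convergent chain. As [n] grows along the chain the radii tend to 0 and every
    triggered condition is eventually met. *)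
Definition refines (n : nat) (s t : index) :=
  [/\ (n <= t.1.2)%N,
      (d (c s.1.1) (c t.1.1) + t.1.2.+1%:R^-1 < s.1.2.+1%:R^-1)%R,
      {subset s.2 <= t.2}
    & forall j, (pickle j < n)%N -> code_holds [set` s.2] (good_P j) ->
                code_holds [set` t.2] (good_Q j)].

(** Write [y] as [g x] with [x] good, then shrink the ball around [g] and enlarge the list at [x];
    [vaught_act_nbhs] tells how far, so as to stay inside [vaught_basic k]. *)
Lemma vaught_refine n s k y : vaught_basic s y -> vaught_basic k y ->
  exists t, [/\ refines n s t, vaught_basic t y &
    vaught_basic t `<=` vaught_basic k].
Proof.
move=> sy ky.
have [g [sg sx gx]] := vaught_hit_good alphaA basic_open rational_ball_base sy.
move: sx gx; set x := alpha (g^-1%g, y) => sx gx.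
have yE : y = alpha (g, x) by rewrite /x actVK.
rewrite yE in ky.
have [W [C [oW Wg oC Cx WC]]] :=
  vaught_act_nbhs alphaA rational_ball_base (rational_ball_base.1 _) ky.
have oCA : open (vaught alpha C (basic_open k.2)).
  apply: openV.
  apply: (vaught_in_unions alphaA rational_ball_base basic_open_base) => //.
  exact: basic_open_base.1.
have [F0 F0x F0C] := basic_open_base.2 _ _ oCA Cx.
have [F1 [sF1 F1x HF1]] := good_code_extend n gx sx.
have [k' [nk' kk' k'g k'W]] := rational_ball_shrink n sg oW Wg.
have F01x : basic_open (F1 ++ F0) x.
  by move=> i /=; rewrite mem_cat => /orP[/F1x|/F0x].
exists (k', F1 ++ F0); split.
- split=> //; first by move=> i /sF1 Fi; rewrite mem_cat Fi.
  move=> j jn /(HF1 j jn); apply: sub_code_holds => i /= Fi.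
  by rewrite mem_cat Fi.
- rewrite yE; apply: (good_vaught alphaA rational_ball_base basic_open_base) => //.
    exact: rational_ball_base.1.
  exact: basic_open_base.1.
- move=> z /(vaught_hit alphaA)[h /k'W Wh F01z].
  rewrite -(actVK alphaA h z); apply: WC => //; apply: F0C => i Fi.
  by apply: F01z; rewrite /= mem_cat orbC [i \in F0]Fi.
Qed.

Lemma vaught_chain (a : set index) : a !=set0 ->
  (forall s k n, a s -> a k -> exists t,
     [/\ refines n s t, a t & vaught_basic t `<=` vaught_basic k]) ->
  exists s : nat -> index, [/\ forall n, a (s n),
    forall n, refines n (s n) (s n.+1) &
    forall k, a k -> exists n, vaught_basic (s n) `<=` vaught_basic k].
Proof.
move=> [s0 as0] ext.
(* Stage [n] attends to the element of [a] coded by [n], if any, so each [k] in [a] is served right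
   after stage [pickle k]. *)
have ext' (p : nat * index) : exists t, a p.2 ->
    [/\ refines p.1 p.2 t, a t & forall k, a k -> unpickle p.1 = Some k ->
      vaught_basic t `<=` vaught_basic k].
  have [ap|] := pselect (a p.2); last by exists p.2.
  have [[k [ak pk]]|nk] := pselect (exists k, a k /\ unpickle p.1 = Some k).
    have [t [pt at_ tk]] := ext p.2 k p.1 ap ak.
    by exists t => _; split=> // k' _; rewrite pk => -[<-].
  have [t [pt at_ _]] := ext p.2 p.2 p.1 ap ap.
  by exists t => _; split=> // k ak kp; case: nk; exists k.
have /choice[f Hf] := ext'.
pose s := fix s n := if n is n'.+1 then f (n', s n') else s0.
have as_ n : a (s n) by elim: n => [|n IH] //=; have [] := Hf (n, s n) IH.
exists s; split=> // [n|k ak]; first by have [] := Hf (n, s n) (as_ n).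
exists (pickle k).+1; have [_ _ H] := Hf (pickle k, s (pickle k)) (as_ _).
by apply: H => //; rewrite pickleK.
Qed.

(** The centres converge to [g] by completeness. The union of the lists satisfies every condition,
    hence is the trace of some [x], and that [x] is good. *)
Lemma vaught_chain_limit (s : nat -> index) :
  (forall n, refines n (s n) (s n.+1)) ->
  exists g x, [/\ good x, forall n, rational_ball (s n).1 g,
    forall n, basic_open (s n).2 x &
    forall W D, open W -> W g -> open D -> D x -> exists n,
      rational_ball (s n).1 `<=` W /\ basic_open (s n).2 `<=` D].
Proof.
move=> ref.
have rad0 n : (0 < (s n).1.2.+1%:R^-1 :> R)%R by rewrite invr_gt0.
have radlim (e : R) : (0 < e)%R ->
    exists N, forall n, (N <= n)%N -> ((s n).1.2.+1%:R^-1 < e)%R.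
  move=> e0; have [N _ HN] := near_infty_natSinv_lt (PosNum e0).
  (* The shift is due to [refines n], which bounds the radius of stage [n.+1]. *)
  exists N.+1 => -[//|n]; rewrite ltnS => Nn; apply: HN => /=.
  by apply: leq_trans Nn _; case: (ref n).
have [||g Hg] := @nested_balls _ _ d dm dG dc (fun n => c (s n).1.1)
    (fun n => (s n).1.2.+1%:R^-1)%R rad0.
- by move=> e /radlim[N HN]; exists N; exact: HN.
- by move=> n; case: (ref n).
have mon n : {subset (s n).2 <= (s n.+1).2} by case: (ref n).
pose a := [set i | exists n, i \in (s n).2].
have sa n : [set` (s n).2] `<=` a by move=> i; exists n.
have acode j : code_holds a (good_P j) -> code_holds a (good_Q j).
  move=> [F PF Fa].
  have [N HN] := @sub_seq_directed _ (fun n => (s n).2) F mon Fa.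
  (* From stage [N] on the list triggers condition [j], and [refines] treats only codes strictly
     below the stage. *)
  have [_ _ _ /(_ j)] := ref (maxn N (pickle j).+1).
  rewrite leq_maxr => /(_ isT) H; apply: sub_code_holds (H _); first exact: sa.
  by exists F => //; apply: HN; rewrite leq_maxl.
case: (codeX) => _ _ _ /(_ a) [/(_ (fun j => acode (inl j)))[x Hx] _].
have xa : [set i | B i x] = a by apply/seteqP; split=> i /Hx.
exists g, x; split.
- by apply/good_pointP; rewrite xa.
- exact: Hg.
- by move=> n i si; apply/Hx; exists n.
move=> W D oW Wg oD Dx.
have [e e0 eW] := metric_openP dG oW Wg.
have [F Fx FD] := basic_open_base.2 _ _ oD Dx.
have [|N HN] := @sub_seq_directed _ (fun n => (s n).2) F mon.
  by move=> i /Fx/Hx.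
have [|M HM] := radlim (e / 2)%R; first lra.
exists (maxn N M); split.
  move=> h; have := Hg (maxn N M); have := HM _ (leq_maxr N M).
  rewrite /rational_ball /=; move: (_^-1)%R => r re sg sh; apply: eW => /=.
  case: (dm) => d0 dE dC dD; have := dD g (c (s (maxn N M)).1.1) h.
  by rewrite (dC g (c _)); lra.
by move=> y sy; apply: FD => i /(HN _ (leq_maxl N M)); exact: sy.
Qed.

(* The left summand lets one follow a refining chain of basic sets through any
   [a] satisfying the conditions; the right one makes [a] upward closed. *)
Definition vaught_P (j : unit + (index * index * nat) + index * index) :
    set (seq index) :=
  match j with
  | inl (inl _) => [set [::]]
  | inl (inr (s, k, n)) => [set [:: s; k]]
  | inr (t, k) => [set F | F = [:: t] /\ vaught_basic t `<=` vaught_basic k]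
  end.

Definition vaught_Q (j : unit + (index * index * nat) + index * index) :
    set (seq index) :=
  match j with
  | inl (inl _) => [set F | exists t, F = [:: t]]
  | inl (inr (s, k, n)) => [set F | exists t, [/\ F = [:: t], refines n s t &
                                    vaught_basic t `<=` vaught_basic k]]
  | inr (t, k) => [set [:: k]]
  end.

Lemma vaught_coding (topO : is_topology OGOX) :
  @quasi_polish_coding (topologized topO) _ _ vaught_basic vaught_P vaught_Q.
Proof.
have oball := rational_ball_base.1; have obasic := basic_open_base.1.
have baireG := complete_metric_baire_space dm dG dc.
have seq1 (a : set index) t : [set` [:: t]] `<=` a <-> a t.
  split=> [|at_ i /=]; first by apply; rewrite /= inE.
  by rewrite inE => /eqP->.
have seq2 (a : set index) s t : [set` [:: s; t]] `<=` a <-> a s /\ a t.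
  split=> [H|[? ?] i /=]; last by rewrite !inE => /orP[]/eqP->.
  by split; apply: H; rewrite /= !inE eqxx ?orbT.
split.
- by move=> t; apply: (vaught_in_unions alphaA rational_ball_base basic_open_base).
- move=> x V /(vaught_unionsP alphaA rational_ball_base basic_open_base).
  move=> H /H[U [A [oU oA Ux UV]]].
  have [k [F [kU FA kx]]] :=
    vaught_base alphaA rational_ball_base basic_open_base oU oA Ux.
  exists [:: (k, F)]; first exact/seq1.
  move=> y /(_ (k, F)) ykF; apply: UV; apply: (sub_vaught alphaA kU FA).
  by apply: ykF; rewrite /= inE.
- move=> x y xy.
  apply: (vaught_separates alphaA rational_ball_base basic_open_base baireG
    balpha basic_open_separates) => k F.
  exact: (xy (k, F)).
move=> a; split=> [H|[y Hy] [[_|[[s k] n]]|[t k]] /=].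
- have [||s [as_ ref hit]] := @vaught_chain a.
  + have [|F [t ->] /seq1 at_] := H (inl (inl tt)); last by exists t.
    exact/code_holds_set1.
  + move=> s k n as_ ak.
    have [|F [t [-> st tk]] /seq1 at_] := H (inl (inr (s, k, n))).
      by apply/code_holds_set1/seq2.
    by exists t.
  (* The point realizing [a] is the image under the action of the limit of a chain inside [a]. *)
  have [g [x [gx sg sx lim]]] := vaught_chain_limit ref.
  exists (alpha (g, x)) => k; split=> [ky|/hit[n]]; last first.
    by apply; exact: (good_vaught alphaA rational_ball_base basic_open_base).
  (* If that point lies in [vaught_basic k], some stage of the chain is already contained in it, and
     upward closure puts [k] into [a]. *)
  have [W [C [oW Wg oC Cx WC]]] :=
    vaught_act_nbhs alphaA rational_ball_base (oball _) ky.
  have [|n [sW sC]] := lim W (vaught alpha C (basic_open k.2)) oW Wg _ Cx.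
    apply: openV.
    exact: (vaught_in_unions alphaA rational_ball_base basic_open_base).
  have [|F -> /seq1//] := H (inr (s n, k)).
  exists [:: s n]; last exact/seq1.
  split=> // z /(vaught_hit alphaA)[h /sW Wh /sC Cz].
  by rewrite -(actVK alphaA h z); exact: WC.
- move=> _.
  have yT : vaught alpha setT setT y.
    by apply: (vaught_contains alphaA baireG (g := 1%g)) => //; exact: openT.
  have [k [F [_ _ kF]]] := vaught_base alphaA rational_ball_base
    basic_open_base openT openT yT.
  by exists [:: (k, F)]; [exists (k, F)|apply/seq1/Hy].
- move=> /code_holds_set1/seq2[/Hy sy /Hy ky].
  have [t [st ty tk]] := vaught_refine n sy ky.
  by exists [:: t]; [exists t|apply/seq1/Hy].
- move=> [_ [-> tk] /seq1/Hy/tk/Hy ak].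
  exact/code_holds_set1/seq1.
Qed.

End vaught_quasi_polish.

(** * Countable bases, and both parts of the theorem *)

Lemma finI_from_sub (T : choiceType) (O D : set (set T)) :
  O setT -> setI_closed O -> D `<=` O -> finI_from D id `<=` O.
Proof.
move=> OT OI DO _ [F FD <-]; rewrite bigcap_fset big_seq.
by elim/big_ind: _ => // A /FD; rewrite inE => /DO.
Qed.

Lemma separable_dense_sequence (T : topologicalType) (x0 : T) :
  separable_space T ->
  exists c : nat -> T, forall V : set T, open V -> V !=set0 -> exists i, V (c i).
Proof.
move=> [D /countable_injP[f finj] denseD].
(* The injection of [D] into [nat] is inverted; numbers coding no point of [D] receive [x0]. *)
have /choice[c Hc] : forall n, exists x, forall y, D y -> f y = n -> x = y.
  move=> n; have [[y [Dy yn]]|ny] := pselect (exists y, D y /\ f y = n).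
    by exists y => z Dz zn; apply: finj; rewrite ?inE// yn.
  by exists x0 => y Dy yn; case: ny; exists y.
exists c => V oV V0; have [y [Vy Dy]] := denseD V V0 oV.
by exists (f y); rewrite (Hc _ y).
Qed.

Theorem theorem3p3p1 (R : realType) (G : topologicalGroupType)
    (X : topologicalType) (alpha : G * X -> X) :
  polish R G -> quasi_polish X -> left_action alpha -> borel_map alpha ->
  let OGOX : set (set X) := vaught_unions alpha open open in
  let UA : set (set X) :=
    [set B | exists U A, [/\ open U, open A & B = vaught alpha U A]] in
  ([/\ continuous alpha <-> OGOX = open,
       OGOX = open <-> basis UA
     & OGOX = open <-> subbasis UA])
  /\
  (OGOX `<=` open ->
   exists topO : is_topology OGOX,
     [/\ OGOX `<=` @open X,
         quasi_polish (topologized topO),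
         OGOX `<=` @borel X
       & continuous
           (alpha : G * topologized topO -> topologized topO)]).
Proof.
move=> [sepG [d [dm dG dc]]] qX alphaA balpha OGOX UA.
have [c c_dense] := separable_dense_sequence 1%g sepG.
have [B [P [Q codeX]]] := quasi_polish_codingP qX.
have baseU := rational_ball_base dm dG c_dense.
have baseA := basic_open_base codeX.
have baireG := complete_metric_baire_space dm dG dc.
have OGOXP := vaught_unionsP alphaA baseU baseA.
have sub_open : UA `<=` open -> OGOX `<=` open.
  move=> oUA V /OGOXP HV; rewrite openE => x /HV[U [A [oU oA Ux UV]]].
  by apply: (filterS UV); apply: open_nbhs_nbhs; split=> //; apply: oUA; exists U, A.
have UA_OGOX : UA `<=` OGOX.
  by move=> _ [U [A [oU oA ->]]]; exact: (vaught_in_unions alphaA baseU baseA).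
have topO : OGOX `<=` open -> is_topology OGOX.
  exact: (vaught_unions_topology alphaA baseU baseA baireG).
have OGOX_basis : OGOX = open -> basis UA.
  move=> OE; split=> [|x N]; first by rewrite -OE.
  rewrite nbhsE => -[V [oV Vx] VN]; rewrite -OE in oV.
  have [U [A [oU oA Ux UV]]] := (OGOXP V).1 oV x Vx.
  exists (vaught alpha U A); last by move=> y /UV/VN.
  by split=> //; exists U, A.
split; first split.
- split; first exact: (continuous_vaught_unions alphaA baseU baseA baireG).
  move=> OE [g x] N; rewrite /= nbhs_simpl nbhsE => -[V [oV Vx] VN].
  rewrite -OE in oV.
  have [W [C [oW Wg oC Cx WC]]] :=
    vaught_unions_act_nbhs alphaA baseU baseA oV Vx.
  exists (W, C) => /=.
    split; apply: open_nbhs_nbhs; split=> //.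
    by move: oC; rewrite -/OGOX OE.
  by move=> [w y] /= [Ww Cy]; apply: VN; exact: WC.
- split=> // -[oUA baseUA]; apply/seteqP; split; first exact: sub_open.
  move=> V oV; apply/OGOXP => x Vx.
  have [|_ [[U [A [oU oA ->]]] Ux] UV] := baseUA x V.
    exact: open_nbhs_nbhs.
  by exists U, A.
- split=> [OE|[oUA [_ baseUA]]].
    have [oUA baseUA] := OGOX_basis OE; split=> //; split.
      by apply: finI_from_sub => //; [exact: openT|exact: openI].
    move=> x N /baseUA[W [UAW Wx] WN]; exists W => //; split=> //.
    exact: (@finI_from1 _ _ UA id).
  have oO := sub_open oUA; apply/seteqP; split=> // V oV.
  (* [OGOX] is closed under finite intersections, so every member of the basis generated by [UA] is
     again a union of transforms. *)
  have [OT OI _] := topO oO.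
  apply/OGOXP => x Vx.
  have [|W [/(finI_from_sub OT OI UA_OGOX) OW Wx] WV] := baseUA x V.
    exact: open_nbhs_nbhs.
  have [U [A [oU oA Ux UW]]] := (OGOXP W).1 OW x Wx.
  by exists U, A; split=> // y /UW/WV.
- move=> oO; exists (topO oO); split=> //.
  + apply: quasi_polish_coding_quasi_polish.
    exact: (vaught_coding dm dG dc c_dense codeX alphaA balpha oO).
  + by move=> V /oO; exact: sub_sigma_algebra.
  + exact: (vaught_unions_continuous alphaA baseU baseA).
Qed.
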